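(* Let $R$ be a ring, $M$ an $(R,R)$-bimodule, and $\alpha$ a ring endomorphism of $R$. Then: (1) The trivial extension $T(R,M)$ is a 2-$\Delta U$ ring if and only if $R$ is a 2-$\Delta U$ ring. (2) For $n\geq 2$, the quotient ring $R[x;\alpha]/\langle x^n\rangle$ is a 2-$\Delta U$ ring if and only if $R$ is a 2-$\Delta U$ ring. (3) For $n\geq 2$, the quotient ring $R[[x;\alpha]]/\langle x^n\rangle$ is a 2-$\Delta U$ ring if and only if $R$ is a 2-$\Delta U$ ring. (4) For $n\ge 1$, the ring $T_n(R)$ of upper triangular $n\times n$ matrices over $R$ is a 2-$\Delta U$ ring if and only if $R$ is a 2-$\Delta U$ ring.
   Context: Rings are associative with identity, not necessarily commutative. $U(R)$ is the group of units of $R$. $\Delta(R)=\{r\in R : r+U(R)\subseteq U(R)\}$. A ring $R$ is called 2-$\Delta U$ if $u^2\in 1+\Delta(R)$ for every $u\in U(R)$. The trivial extension is $T(R,M)=\{(r,m): r\in R, m\in M\}$ with componentwise addition and multiplication $(r,m)(s,n)=(rs,rn+ms)$. $R[x;\alpha]$ (resp. $R[[x;\alpha]]$) is the skew polynomial (resp. skew formal power series) ring over $R$, coefficients on the left, with multiplication determined by $xr=\alpha(r)x$ for $r\in R$. Ring endomorphisms preserve the identity. $\langle x^n\rangle$ denotes the two-sided ideal generated by $x^n$. *)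

(* Defs.v *)
From HB Require Import structures.
From mathcomp Require Import all_boot all_order all_algebra.
From mathcomp Require Import boolp classical_sets.

Set Implicit Arguments.
Unset Strict Implicit.
Unset Printing Implicit Defensive.

Import GRing.Theory.

Local Open Scope ring_scope.
Local Open Scope classical_set_scope.

(* [GRing.unit] needs the [unitRingType] interface, i.e. a computable inverse
   function, so for an arbitrary ring the units are defined here as a set.   *)
Definition units (R : pzRingType) : set R :=
  [set u | exists v, u * v = 1 /\ v * u = 1].
Arguments units : clear implicits.

Definition Delta (R : pzRingType) : set R :=
  [set r | [set r + u | u in units R] `<=` units R].
Arguments Delta : clear implicits.

Definition two_DeltaU (R : pzRingType) : Prop :=
  forall u : R, units R u -> [set 1 + r | r in Delta R] (u ^+ 2).

(* An (R, R)-bimodule: a left module with a unital right action that is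
   biadditive and commutes with the left one. *)
HB.mixin Record Lmodule_isBimodule (R : pzRingType) M of GRing.Lmodule R M := {
  ract : M -> R -> M;
  ractA : forall m a b, ract (ract m a) b = ract m (a * b);
  ract1 : forall m, ract m 1 = m;
  ractDl : forall a, {morph ract^~ a : m n / m + n};
  ractDr : forall m, {morph ract m : a b / a + b};
  scaler_ract : forall a m b, a *: ract m b = ract (a *: m) b
}.

#[short(type="bimodType")]
HB.structure Definition Bimodule (R : pzRingType) :=
  {M of Lmodule_isBimodule R M & GRing.Lmodule R M}.

Section TrivialExtension.
Variables (R : pzRingType) (M : bimodType R).

Definition trivext : Type := R * M.

HB.instance Definition _ := GRing.Zmodule.on trivext.

Definition trivext_one : trivext := (1, 0).
Definition trivext_mul (x y : trivext) : trivext :=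
  (x.1 * y.1, x.1 *: y.2 + ract x.2 y.1).

Lemma ract0l (a : R) : ract (0 : M) a = 0.
Proof. by apply: (addrI (ract (0 : M) a)); rewrite -ractDl !addr0. Qed.

Lemma ract0r (m : M) : ract m 0 = 0.
Proof. by apply: (addrI (ract m 0)); rewrite -ractDr !addr0. Qed.

Lemma trivext_mulA : associative trivext_mul.
Proof.
case=> [a m] [b n] [c p]; rewrite /trivext_mul /= mulrA; congr (_, _).
by rewrite scalerDr scalerA ractDl ractA scaler_ract addrA.
Qed.

Lemma trivext_mul1l : left_id trivext_one trivext_mul.
Proof. by case=> [a m]; rewrite /trivext_mul /= mul1r scale1r ract0l addr0. Qed.

Lemma trivext_mul1r : right_id trivext_one trivext_mul.
Proof. by case=> [a m]; rewrite /trivext_mul /= mulr1 ract1 scaler0 add0r. Qed.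

Lemma trivext_mulDl : left_distributive trivext_mul +%R.
Proof.
case=> [a m] [b n] [c p]; rewrite /trivext_mul; congr (_, _) => /=.
  exact: mulrDl.
by rewrite scalerDl ractDl addrACA.
Qed.

Lemma trivext_mulDr : right_distributive trivext_mul +%R.
Proof.
case=> [a m] [b n] [c p]; rewrite /trivext_mul; congr (_, _) => /=.
  exact: mulrDr.
by rewrite scalerDr ractDr addrACA.
Qed.

HB.instance Definition _ := GRing.Zmodule_isPzRing.Build trivext
  trivext_mulA trivext_mul1l trivext_mul1r trivext_mulDl trivext_mulDr.

End TrivialExtension.

(* [f : skew_series alpha] stands for the series \sum_i (f i) x^i, coefficients
   on the left; its product comes from
   (a x^i) (b x^j) = a (alpha^i b) x^(i + j).                               *)
Definition skew_series (R : pzRingType) (alpha : {rmorphism R -> R}) : Type :=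
  nat -> R.

Section SkewSeries.
Variables (R : pzRingType) (alpha : {rmorphism R -> R}).
Local Notation skew_series := (skew_series alpha).

HB.instance Definition _ := Choice.copy skew_series (nat -> R).

Implicit Types f g h : skew_series.

Lemma skew_addA : associative (fun f g i => f i + g i : R).
Proof. by move=> f g h; apply/funext => i; rewrite addrA. Qed.
Lemma skew_addC : commutative (fun f g i => f i + g i : R).
Proof. by move=> f g; apply/funext => i; rewrite addrC. Qed.
Lemma skew_add0 : left_id (fun=> 0) (fun f g i => f i + g i : R).
Proof. by move=> f; apply/funext => i; rewrite add0r. Qed.
Lemma skew_addN :
  left_inverse (fun=> 0) (fun f i => - f i) (fun f g i => f i + g i : R).
Proof. by move=> f; apply/funext => i; rewrite addNr. Qed.

HB.instance Definition _ := GRing.isZmodule.Build skew_series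
  skew_addA skew_addC skew_add0 skew_addN.

Definition skew_const (c : R) : skew_series := fun i => if i is 0 then c else 0.
Definition skew_mul f g : skew_series :=
  fun n => \sum_(i < n.+1) f i * iter i alpha (g (n - i)%N).

Lemma iter_alpha0 i : iter i alpha 0 = 0.
Proof. by elim: i => //= i ->; rewrite rmorph0. Qed.
Lemma iter_alpha1 i : iter i alpha 1 = 1.
Proof. by elim: i => //= i ->; rewrite rmorph1. Qed.
Lemma iter_alphaD i : {morph iter i alpha : a b / a + b}.
Proof. by move=> a b; elim: i => //= i ->; rewrite rmorphD. Qed.
Lemma iter_alphaM i : {morph iter i alpha : a b / a * b}.
Proof. by move=> a b; elim: i => //= i ->; rewrite rmorphM. Qed.
Lemma iter_alpha_sum i n (F : nat -> R) :
  iter i alpha (\sum_(j < n) F j) = \sum_(j < n) iter i alpha (F j).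
Proof.
elim: n => [|n IHn]; first by rewrite !big_ord0 iter_alpha0.
by rewrite !big_ord_recr /= iter_alphaD IHn.
Qed.

Lemma triangular_sum (F : nat -> nat -> R) n :
  \sum_(k < n.+1) \sum_(i < k.+1) F i (k - i)%N =
  \sum_(i < n.+1) \sum_(j < (n - i).+1) F i j.
Proof.
elim: n => [|n IHn]; first by rewrite !big_ord1.
rewrite big_ord_recr IHn /= [RHS]big_ord_recr /= subnn big_ord1.
rewrite [X in _ + X]big_ord_recr /= subnn addrA -big_split; congr (_ + _).
apply: eq_bigr => i _ /=; rewrite subSn -1?ltnS ?ltn_ord //.
by rewrite [RHS]big_ord_recr.
Qed.

Lemma skew_mulA : associative skew_mul.
Proof.
move=> f g h; apply/funext => n; rewrite /skew_mul.
pose F i j := f i * iter i alpha (g j) * iter (i + j) alpha (h (n - (i + j))%N).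
transitivity (\sum_(i < n.+1) \sum_(j < (n - i).+1) F i j).
  apply: eq_bigr => i _ /=.
  rewrite (iter_alpha_sum i _ (fun j => g j * iter j alpha (h (n - i - j)%N))).
  rewrite mulr_sumr.
  apply: eq_bigr => j _.
  by rewrite /F iter_alphaM mulrA iterD subnDA.
rewrite -triangular_sum; apply: eq_bigr => k _; rewrite mulr_suml.
by apply: eq_bigr => i _; rewrite /F subnKC // -ltnS.
Qed.

Lemma skew_mul1l : left_id (skew_const 1) skew_mul.
Proof.
move=> f; apply/funext => n; rewrite /skew_mul big_ord_recl /= mul1r subn0.
by rewrite big1 ?addr0 // => i _; rewrite mul0r.
Qed.

Lemma skew_mul1r : right_id (skew_const 1) skew_mul.
Proof.
move=> f; apply/funext => n; rewrite /skew_mul big_ord_recr /= subnn.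
rewrite iter_alpha1 mulr1 big1 ?add0r // => i _.
rewrite /skew_const; case E: (n - i)%N => [|m]; last by rewrite iter_alpha0 mulr0.
by have := ltn_ord i; rewrite -subn_gt0 E.
Qed.

Lemma skew_mulDl : left_distributive skew_mul +%R.
Proof.
move=> f g h; apply/funext => n.
rewrite [RHS]/GRing.add /= /skew_mul -big_split; apply: eq_bigr => i _.
exact: mulrDl.
Qed.

Lemma skew_mulDr : right_distributive skew_mul +%R.
Proof.
move=> f g h; apply/funext => n.
rewrite [RHS]/GRing.add /= /skew_mul -big_split; apply: eq_bigr => i _.
by rewrite [X in iter _ _ X]/GRing.add /= iter_alphaD mulrDr.
Qed.

HB.instance Definition _ := GRing.Zmodule_isPzRing.Build skew_series
  skew_mulA skew_mul1l skew_mul1r skew_mulDl skew_mulDr.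

Definition skew_seriesX : skew_series := fun i => (i == 1%N)%:R.

Lemma skew_seriesX_const (r : R) :
  skew_seriesX * skew_const r = skew_const (alpha r) * skew_seriesX.
Proof.
apply/funext => n.
have -> : (skew_const (alpha r) * skew_seriesX) n = alpha r * (n == 1%N)%:R.
  rewrite [LHS]big_ord_recl big1 ?addr0 => [|i _]; last by rewrite mul0r.
  by rewrite /= subn0.
case: n => [|n]; first by rewrite [LHS]big_ord1 mul0r mulr0.
rewrite [LHS]big_ord_recl big_ord_recl mul0r add0r big1 => [|i _]; last first.
  by rewrite mul0r.
by case: n => [|n] /=; rewrite addr0 mul1r ?mulr1 ?rmorph0 ?mulr0.
Qed.

Definition finite_skew_series : {pred skew_series} :=
  fun f => `[< exists n, forall i, (n <= i)%N -> f i = 0 >].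

Lemma finite_skew_series_subring : subring_closed finite_skew_series.
Proof.
split=> [|f g /asboolP[m fm] /asboolP[n gn]|f g /asboolP[m fm] /asboolP[n gn]].
- by apply/asboolP; exists 1%N; case.
- apply/asboolP; exists (maxn m n) => i; rewrite geq_max => /andP[mi ni].
  by rewrite /GRing.add /GRing.opp /= fm // gn // subr0.
- apply/asboolP; exists (m + n)%N => i mni.
  rewrite /GRing.mul /= /skew_mul big1 // => j _.
  have [mj|jm] := leqP m j; first by rewrite fm ?mul0r.
  rewrite gn ?iter_alpha0 ?mulr0 // leq_subRL; last by rewrite -ltnS.
  by rewrite (leq_trans _ mni) // leq_add2r ltnW.
Qed.

HB.instance Definition _ := GRing.isSubringClosed.Build skew_series
  finite_skew_series finite_skew_series_subring.

Record skew_poly := SkewPoly {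
  skew_poly_val :> skew_series;
  skew_poly_finite : skew_poly_val \in finite_skew_series
}.

HB.instance Definition _ := [isSub for skew_poly_val].
HB.instance Definition _ := [Choice of skew_poly by <:].
HB.instance Definition _ :=
  GRing.SubChoice_isSubPzRing.Build skew_series finite_skew_series skew_poly
    finite_skew_series_subring.

Lemma skew_seriesX_finite : skew_seriesX \in finite_skew_series.
Proof. by apply/asboolP; exists 2%N; do 2?case. Qed.

Definition skew_polyX : skew_poly := SkewPoly skew_seriesX_finite.

End SkewSeries.

Arguments skew_poly {R} alpha.
Arguments skew_const {R} alpha c.
Arguments skew_seriesX {R} alpha.
Arguments skew_polyX {R} alpha.

(* The ring quotients of ring_quotient.v only cover commutative rings and
   proper ideals; [Quotient.quot] itself, which quotients by an additive
   subgroup, is given a ring structure here for any two-sided ideal.       *)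
HB.mixin Record isTwoSidedIdeal (A : pzRingType) (I : A -> bool) := {
  ideal_mull : forall a x : A, x \in I -> a * x \in I;
  ideal_mulr : forall a x : A, x \in I -> x * a \in I
}.

#[short(type="twoSidedIdeal")]
HB.structure Definition TwoSidedIdeal (A : pzRingType) :=
  {I of GRing.ZmodClosed A I & isTwoSidedIdeal A I}.

Section QuotientRing.
Variables (A : pzRingType) (I : twoSidedIdeal A).
Local Open Scope quotient_scope.

Definition quot_ring : Type := Quotient.quot I.

HB.instance Definition _ := GRing.Zmodule.on quot_ring.
HB.instance Definition _ := EqQuotient.on quot_ring.

Definition quot_pi (x : A) : quot_ring := \pi_(Quotient.quot I) x.

Lemma quot_piP (q : quot_ring) : exists x : A, q = quot_pi x.
Proof. by exists (repr q); rewrite /quot_pi reprK. Qed.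

Lemma quot_pi_eq (x y : A) : quot_pi x = quot_pi y <-> x - y \in I.
Proof.
rewrite (Quotient.idealrBE I x y).
by split => [e|/eqP//]; apply/eqP.
Qed.

Lemma quot_piD (x y : A) : quot_pi (x + y) = quot_pi x + quot_pi y.
Proof. exact: (Quotient.pi_add I). Qed.

Lemma quot_piB (x y : A) : quot_pi (x - y) = quot_pi x - quot_pi y.
Proof. by rewrite quot_piD; congr (_ + _); exact: (Quotient.pi_opp I). Qed.

Definition quot_mul (p q : quot_ring) : quot_ring :=
  quot_pi (repr p * repr q : A).

Lemma quot_piM (x y : A) : quot_pi (x * y) = quot_mul (quot_pi x) (quot_pi y).
Proof.
apply/quot_pi_eq; set x' := repr _; set y' := repr _.
have Ix : x - x' \in I by apply/quot_pi_eq; rewrite /quot_pi reprK.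
have Iy : y - y' \in I by apply/quot_pi_eq; rewrite /quot_pi reprK.
have -> : x * y - x' * y' = (x - x') * y + x' * (y - y').
  by rewrite mulrBl mulrBr addrA subrK.
by apply: rpredD; [apply: ideal_mulr | apply: ideal_mull].
Qed.

Lemma quot_mulA : associative quot_mul.
Proof.
move=> p q r; have [x ->] := quot_piP p; have [y ->] := quot_piP q.
by have [z ->] := quot_piP r; rewrite -4!quot_piM mulrA.
Qed.
Lemma quot_mul1l : left_id (quot_pi 1) quot_mul.
Proof. by move=> p; have [x ->] := quot_piP p; rewrite -quot_piM mul1r. Qed.
Lemma quot_mul1r : right_id (quot_pi 1) quot_mul.
Proof. by move=> p; have [x ->] := quot_piP p; rewrite -quot_piM mulr1. Qed.
Lemma quot_mulDl : left_distributive quot_mul +%R.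
Proof.
move=> p q r; have [x ->] := quot_piP p; have [y ->] := quot_piP q.
have [z ->] := quot_piP r.
by rewrite -quot_piD -3!quot_piM mulrDl quot_piD.
Qed.
Lemma quot_mulDr : right_distributive quot_mul +%R.
Proof.
move=> p q r; have [x ->] := quot_piP p; have [y ->] := quot_piP q.
have [z ->] := quot_piP r.
by rewrite -quot_piD -3!quot_piM mulrDr quot_piD.
Qed.

HB.instance Definition _ := GRing.Zmodule_isPzRing.Build quot_ring
  quot_mulA quot_mul1l quot_mul1r quot_mulDl quot_mulDr.

HB.instance Definition _ := GRing.isZmodMorphism.Build A quot_ring quot_pi
  quot_piB.
HB.instance Definition _ := GRing.isMonoidMorphism.Build A quot_ring quot_pi
  (erefl, quot_piM).

End QuotientRing.

Section GeneratedIdeal.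
Variables (A : pzRingType) (a : A).

Definition ideal_gen : {pred A} :=
  fun x => `[< forall I : twoSidedIdeal A, a \in I -> x \in I >].

Lemma ideal_gen_zmod : zmod_closed ideal_gen.
Proof.
split=> [|x y /asboolP Ix /asboolP Iy]; apply/asboolP => I Ia.
  exact: rpred0.
by rewrite rpredB ?Ix ?Iy.
Qed.
HB.instance Definition _ := GRing.isZmodClosed.Build A ideal_gen ideal_gen_zmod.

Lemma ideal_gen_mull (b x : A) : x \in ideal_gen -> b * x \in ideal_gen.
Proof. by move=> /asboolP Ix; apply/asboolP => I Ia; rewrite ideal_mull ?Ix. Qed.
Lemma ideal_gen_mulr (b x : A) : x \in ideal_gen -> x * b \in ideal_gen.
Proof. by move=> /asboolP Ix; apply/asboolP => I Ia; rewrite ideal_mulr ?Ix. Qed.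
HB.instance Definition _ := isTwoSidedIdeal.Build A ideal_gen
  ideal_gen_mull ideal_gen_mulr.

End GeneratedIdeal.

Section UpperTriangular.
Variables (R : pzRingType) (n : nat).

(* [is_trig_mx] means lower triangular. *)
Definition upper_trig : {pred 'M[R]_n} := fun A => is_trig_mx A^T.

Lemma upper_trigP (A : 'M[R]_n) :
  reflect (forall i j : 'I_n, (j < i)%N -> A i j = 0) (A \in upper_trig).
Proof.
apply: (iffP is_trig_mxP) => trigA i j ij; last by rewrite mxE trigA.
by rewrite -(trigA j i ij) mxE.
Qed.

Lemma upper_trig_subring : subring_closed upper_trig.
Proof.
split=> [|A B /upper_trigP A0 /upper_trigP B0|A B /upper_trigP A0 /upper_trigP B0];
  apply/upper_trigP => i j ji.
- by rewrite mxE -val_eqE gtn_eqF.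
- by rewrite !mxE A0 ?B0 ?subr0.
- rewrite mxE big1 // => k _; have [ki|ik] := ltnP k i; first by rewrite A0 ?mul0r.
  by rewrite B0 ?mulr0 // (leq_trans ji).
Qed.

HB.instance Definition _ := GRing.isSubringClosed.Build 'M[R]_n
  upper_trig upper_trig_subring.

Record trig_mx := TrigMx {
  trig_mx_val :> 'M[R]_n;
  trig_mx_upper : trig_mx_val \in upper_trig
}.

HB.instance Definition _ := [isSub for trig_mx_val].
HB.instance Definition _ := [Choice of trig_mx by <:].
HB.instance Definition _ :=
  GRing.SubChoice_isSubPzRing.Build 'M[R]_n upper_trig trig_mx
    upper_trig_subring.

End UpperTriangular.

(* Main.v *)
Require Import Defs.
From HB Require Import structures.
From mathcomp Require Import all_boot all_order all_algebra.
From mathcomp Require Import boolp classical_sets.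
Set Implicit Arguments.
Unset Strict Implicit.
Unset Printing Implicit Defensive.

Import GRing.Theory.

Local Open Scope ring_scope.

(* Each of the rings S in the theorem comes with a surjective ring morphism
   S -> R^I with nil kernel, I a nonempty index set: the base coordinate of
   T(R, M), the constant coefficient, the diagonal of a triangular matrix.
   Such a morphism reflects units, hence s is in Delta(S) iff all its images
   are in Delta(R), and the condition on u^2 - 1 can be tested in R. *)

(** * Units, and the condition restated through [u ^+ 2 - 1] *)

Lemma two_DeltaUE (R : pzRingType) :
  two_DeltaU R <-> forall u : R, units R u -> Delta R (u ^+ 2 - 1).
Proof.
split=> [RU u /RU[r Dr <-]|RU u /RU Du]; first by rewrite addrC addKr.
by exists (u ^+ 2 - 1) => //; rewrite addrC subrK.
Qed.

Lemma units_one_sided (R : pzRingType) (u v w : R) :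
  u * v = 1 -> w * u = 1 -> units R u.
Proof.
move=> uv wu; exists v; split=> //.
by rewrite -[v]mul1r -{1}wu -(mulrA w) uv mulr1.
Qed.

Lemma units_rmorph (S R : pzRingType) (f : {rmorphism S -> R}) (s : S) :
  units S s -> units R (f s).
Proof. by case=> t [st ts]; exists (f t); rewrite -!rmorphM st ts rmorph1. Qed.

(** The finite geometric series in [x] inverts [1 - x], on both sides because it commutes with
    [x]. *)
Lemma units_1Bnilpotent (R : pzRingType) (x : R) (n : nat) :
  x ^+ n = 0 -> units R (1 - x).
Proof.
move=> xn0; pose g := \sum_(i < n) x ^+ i.
have e : (1 - x) * g = 1.
  by rewrite -[1 - x]opprB mulNr -subrX1 xn0 sub0r opprK.
exists g; split=> //; rewrite -[RHS]e; apply: commr_sym.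
apply: commr_sum => i _; apply: commrX; apply: commr_sym.
by apply: commrB; [exact: commr1 | exact: commr_refl].
Qed.

(** * Transfer along a surjection onto a power of R with nil kernel *)

Section NilKernel.
Variables (S R : pzRingType) (I : Type) (phi : I -> {rmorphism S -> R}).
Hypothesis phi_onto : forall r : I -> R, exists s, forall i, phi i s = r i.
Hypothesis phi_nil :
  forall s, (forall i, phi i s = 0) -> exists n, s ^+ n = 0.

(** Coordinatewise inverses of [s] lift to a single [t]. Then [s * t] and [t * s] are both 1 minus a
    nilpotent, hence units, which makes [s] invertible on each side. *)
Lemma units_nil_kernel (s : S) : units S s <-> forall i, units R (phi i s).
Proof.
split=> [Us i|Us]; first exact: units_rmorph.
have [v sv] := choice Us; have [t tv] := phi_onto v.
have U1 x : (forall i, phi i x = 1) -> units S x.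
  move=> x1; rewrite -[x](subKr 1).
  have [i|n] := @phi_nil (1 - x); first by rewrite rmorphB rmorph1 x1 subrr.
  exact: units_1Bnilpotent.
have [i|a [sta _]] := U1 (s * t).
  by rewrite rmorphM tv; case: (sv i).
have [i|b [_ bts]] := U1 (t * s).
  by rewrite rmorphM tv; case: (sv i).
by apply: (@units_one_sided _ _ (t * a) (b * t)); rewrite ?mulrA // -mulrA.
Qed.

Lemma Delta_nil_kernel (s : S) : Delta S s <-> forall i, Delta R (phi i s).
Proof.
split=> [Ds i _ [u Uu <-]|Ds _ [u Uu <-]].
  (* Lifting the constant family, not just coordinate [i], makes [t] a unit of [S], so that [Ds]
     applies to it. *)
  have [t tu] := phi_onto (fun=> u).
  rewrite -(tu i) -rmorphD; apply/units_rmorph/Ds; exists t => //.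
  by apply/units_nil_kernel => j; rewrite tu.
apply/units_nil_kernel => i; rewrite rmorphD.
by apply: (Ds i); exists (phi i u) => //; exact: units_rmorph.
Qed.

Lemma two_DeltaU_nil_kernel : inhabited I -> two_DeltaU S <-> two_DeltaU R.
Proof.
have phiE i s : phi i (s ^+ 2 - 1) = phi i s ^+ 2 - 1.
  by rewrite rmorphB rmorphXn rmorph1.
case=> i0; split=> /two_DeltaUE RU; apply/two_DeltaUE => u Uu.
  (* Again the constant family gives a unit of [S]; coordinate [i0] brings the conclusion back to
     [R]. *)
  have [s su] := phi_onto (fun=> u); rewrite -(su i0) -phiE.
  suff /Delta_nil_kernel : Delta S (s ^+ 2 - 1) by apply.
  by apply/RU/units_nil_kernel => i; rewrite su.
by apply/Delta_nil_kernel => i; rewrite phiE; apply/RU/units_rmorph.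
Qed.

End NilKernel.

(** * Morphisms out of the quotient by the ideal of one element *)

Section Kernel.
Variables (A R : pzRingType) (f : {rmorphism A -> R}).

(** Test ideal: [ideal_gen a] lies in every two-sided ideal containing [a], hence in this kernel
    once [f a = 0]. *)
Definition ker_ideal : {pred A} := fun x => f x == 0.

Lemma ker_ideal_zmod : zmod_closed ker_ideal.
Proof.
split=> [|x y /eqP x0 /eqP y0]; apply/eqP; first exact: rmorph0.
by rewrite rmorphB x0 y0 subrr.
Qed.
HB.instance Definition _ := GRing.isZmodClosed.Build A ker_ideal ker_ideal_zmod.

Lemma ker_ideal_mull (b x : A) : x \in ker_ideal -> b * x \in ker_ideal.
Proof. by move=> /eqP x0; apply/eqP; rewrite rmorphM x0 mulr0. Qed.
Lemma ker_ideal_mulr (b x : A) : x \in ker_ideal -> x * b \in ker_ideal.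
Proof. by move=> /eqP x0; apply/eqP; rewrite rmorphM x0 mul0r. Qed.
HB.instance Definition _ := isTwoSidedIdeal.Build A ker_ideal
  ker_ideal_mull ker_ideal_mulr.

End Kernel.

Section QuotientLift.
Variables (A R : pzRingType) (J : twoSidedIdeal A) (f : {rmorphism A -> R}).
Hypothesis fJ0 : forall x, x \in J -> f x = 0.

(* The proof argument makes the morphism instances below available to
   inference once the kernel condition is established. *)
Definition quot_lift of (forall x, x \in J -> f x = 0) : quot_ring J -> R :=
  fun q => f (repr q).
Local Notation lift := (quot_lift fJ0).

Lemma quot_lift_pi (x : A) : lift (quot_pi J x) = f x.
Proof.
apply/eqP; rewrite -subr_eq0 -rmorphB; apply/eqP/fJ0/quot_pi_eq.
by rewrite /quot_pi reprK.
Qed.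

Lemma quot_lift_zmod_morphism : zmod_morphism lift.
Proof.
move=> p q; have [x ->] := quot_piP p; have [y ->] := quot_piP q.
by rewrite -rmorphB !quot_lift_pi rmorphB.
Qed.

Lemma quot_lift_monoid_morphism : monoid_morphism lift.
Proof.
split=> [|p q]; first by rewrite -(rmorph1 (quot_pi J)) quot_lift_pi rmorph1.
have [x ->] := quot_piP p; have [y ->] := quot_piP q.
by rewrite -rmorphM !quot_lift_pi rmorphM.
Qed.

HB.instance Definition _ := GRing.isZmodMorphism.Build (quot_ring J) R lift
  quot_lift_zmod_morphism.
HB.instance Definition _ := GRing.isMonoidMorphism.Build (quot_ring J) R lift
  quot_lift_monoid_morphism.

End QuotientLift.

(** Since [f] kills [a], it factors through the quotient; a power in [ideal_gen a] vanishes there,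
    so the induced map has nil kernel. The index set is a single point. *)
Lemma two_DeltaU_quot_gen (A R : pzRingType) (f : {rmorphism A -> R}) (a : A) :
    (forall r, exists x, f x = r) -> f a = 0 ->
    (forall x, f x = 0 -> exists n, x ^+ n \in ideal_gen a) ->
  two_DeltaU (quot_ring (ideal_gen a)) <-> two_DeltaU R.
Proof.
move=> f_onto fa0 f_nil.
have fJ0 x : x \in ideal_gen a -> f x = 0.
  by move=> /asboolP/(_ (ker_ideal f : twoSidedIdeal A)) Ix; apply/eqP/Ix/eqP.
apply: (@two_DeltaU_nil_kernel _ _ unit (fun=> quot_lift fJ0)) => //.
  move=> r; have [x xr] := f_onto (r tt); exists (quot_pi _ x) => -[].
  by rewrite /= quot_lift_pi.
move=> q; have [x ->] := quot_piP q => /(_ tt); rewrite /= quot_lift_pi.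
move=> /f_nil[n xn]; exists n; rewrite -rmorphXn -(rmorph0 (quot_pi _)).
by apply/quot_pi_eq; rewrite subr0.
Qed.

(** * Trivial extensions *)

Section TrivialExtension.
Variables (R : pzRingType) (M : bimodType R).

Definition trivext_base (x : trivext M) : R := x.1.

Lemma trivext_base_zmod_morphism : zmod_morphism trivext_base.
Proof. by []. Qed.
Lemma trivext_base_monoid_morphism : monoid_morphism trivext_base.
Proof. by []. Qed.
HB.instance Definition _ := GRing.isZmodMorphism.Build (trivext M) R
  trivext_base trivext_base_zmod_morphism.
HB.instance Definition _ := GRing.isMonoidMorphism.Build (trivext M) R
  trivext_base trivext_base_monoid_morphism.

Lemma two_DeltaU_trivext : two_DeltaU (trivext M) <-> two_DeltaU R.
Proof.
apply: (@two_DeltaU_nil_kernel _ _ unit (fun=> trivext_base)) => //.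
  by move=> r; exists (r tt, 0) => -[].
(* The kernel consists of the pairs (0, m), and these square to zero. *)
move=> [a m] /(_ tt) /= a0; exists 2; rewrite expr2.
rewrite [LHS]/GRing.mul /= /trivext_mul /=.
by move: a0; rewrite /trivext_base /= => ->; rewrite mulr0 scale0r ract0r addr0.
Qed.

End TrivialExtension.

(** * Skew power series and skew polynomials modulo X^n *)

Section SkewSeries.
Variables (R : pzRingType) (alpha : {rmorphism R -> R}).
Implicit Types f g : skew_series alpha.

Lemma skew_mulE f g n :
  (f * g) n = \sum_(i < n.+1) f i * iter i alpha (g (n - i)%N).
Proof. by []. Qed.

Definition skew_coef0 f : R := f 0%N.

Lemma skew_coef0_zmod_morphism : zmod_morphism skew_coef0.
Proof. by []. Qed.
Lemma skew_coef0_monoid_morphism : monoid_morphism skew_coef0.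
Proof. by split=> // f g; rewrite /skew_coef0 skew_mulE big_ord1. Qed.
HB.instance Definition _ := GRing.isZmodMorphism.Build (skew_series alpha) R
  skew_coef0 skew_coef0_zmod_morphism.
HB.instance Definition _ := GRing.isMonoidMorphism.Build (skew_series alpha) R
  skew_coef0 skew_coef0_monoid_morphism.

(** Each factor without constant term raises the order by at least one; the twists by [alpha]
    preserve zero coefficients. *)
Lemma skew_coef_exp f n i : f 0%N = 0 -> (i < n)%N -> (f ^+ n) i = 0.
Proof.
move=> f0; elim: n i => // n IHn i; rewrite ltnS => i_n.
rewrite exprS skew_mulE big_ord_recl f0 mul0r add0r big1 // => j _.
rewrite IHn ?iter_alpha0 ?mulr0 //.
by rewrite (leq_trans _ i_n) // ltn_subrL (leq_ltn_trans _ (ltn_ord j)).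
Qed.

(** On the right, X merely shifts: the twists hit only its coefficients 0 and 1, which they fix. *)
Lemma skew_mulX f i :
  (f * skew_seriesX alpha) i = if i is i'.+1 then f i' else 0.
Proof.
case: i => [|i]; rewrite skew_mulE; first by rewrite big_ord1 mulr0.
rewrite big_ord_recr big_ord_recr /= subnn subSn // subnn.
rewrite /skew_seriesX /= iter_alpha0 rmorph0 mulr0 addr0 iter_alpha1 mulr1.
rewrite big1 ?add0r // => j _; rewrite subSn 1?ltnW // eqSS subn_eq0 leqNgt.
by rewrite ltn_ord iter_alpha0 mulr0.
Qed.

Lemma skew_mulXn f n i :
  (f * skew_seriesX alpha ^+ n) i = if (i < n)%N then 0 else f (i - n)%N.
Proof.
elim: n i => [|n IHn] i; first by rewrite mulr1 subn0.
by rewrite exprSr mulrA skew_mulX; case: i => [|i] //; rewrite IHn ltnS subSS.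
Qed.

Definition skew_shift f n : skew_series alpha := fun i => f (i + n)%N.

(** The power of X is split off on the right, where no twist appears; on the left only coefficients
    in the image of the n-th iterate of [alpha] could be reached. *)
Lemma skew_series_divXn f n : (forall i, (i < n)%N -> f i = 0) ->
  f = skew_shift f n * skew_seriesX alpha ^+ n.
Proof.
move=> f0; apply/funext => i; rewrite skew_mulXn /skew_shift.
by case: ltnP => [/f0//|ni]; rewrite subnK.
Qed.

Lemma skew_const_finite (c : R) :
  skew_const alpha c \in finite_skew_series (alpha := alpha).
Proof. by apply/asboolP; exists 1%N; case. Qed.

Lemma skew_shift_finite f n : f \in finite_skew_series (alpha := alpha) ->
  skew_shift f n \in finite_skew_series (alpha := alpha).
Proof.
move=> /asboolP[m fm]; apply/asboolP; exists m => i mi.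
by rewrite /skew_shift fm // (leq_trans mi) ?leq_addr.
Qed.

Lemma two_DeltaU_skew_series n : (0 < n)%N ->
  two_DeltaU (quot_ring (ideal_gen (skew_seriesX alpha ^+ n))) <->
  two_DeltaU R.
Proof.
move=> n_gt0; apply: (@two_DeltaU_quot_gen _ _ skew_coef0).
- by move=> r; exists (skew_const alpha r).
- by rewrite rmorphXn /= expr0n gtn_eqF.
move=> f f0; exists n; rewrite (@skew_series_divXn (f ^+ n) n).
  by apply: ideal_mull; apply/asboolP.
by move=> i; exact: skew_coef_exp.
Qed.

Lemma two_DeltaU_skew_poly n : (0 < n)%N ->
  two_DeltaU (quot_ring (ideal_gen (skew_polyX alpha ^+ n))) <-> two_DeltaU R.
Proof.
move=> n_gt0; pose v : {rmorphism skew_poly alpha -> skew_series alpha} := val.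
apply: (@two_DeltaU_quot_gen _ _ (skew_coef0 \o v)).
- by move=> r; exists (SkewPoly (skew_const_finite r)).
- by rewrite rmorphXn /= expr0n gtn_eqF.
move=> f f0; exists n.
(* The cofactor found among series is a shift of a finite series, so the factorization already holds
   among polynomials. *)
pose g := SkewPoly (skew_shift_finite n (valP (f ^+ n))).
suff -> : f ^+ n = g * skew_polyX alpha ^+ n.
  by apply: ideal_mull; apply/asboolP.
apply: val_inj; transitivity (v g * skew_seriesX alpha ^+ n); last first.
  by rewrite (rmorphM v) (rmorphXn v).
apply: skew_series_divXn => i; rewrite (rmorphXn v); exact: skew_coef_exp.
Qed.

End SkewSeries.

(** * Upper triangular matrices *)

Section UpperTriangular.
Variables (R : pzRingType) (n : nat).

Definition trig_diag (i : 'I_n) (A : trig_mx R n) : R := \val A i i.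

Lemma trig_diag_zmod_morphism i : zmod_morphism (trig_diag i).
Proof. by move=> A B; rewrite /trig_diag raddfB !mxE. Qed.
Lemma trig_diag_monoid_morphism i : monoid_morphism (trig_diag i).
Proof.
split=> [|A B]; rewrite /trig_diag ?rmorph1 ?rmorphM; first by rewrite mxE eqxx.
rewrite mxE (bigD1 i) //= big1 ?addr0 // => j; rewrite neq_ltn.
(* Off the diagonal, either the entry of [A] or the one of [B] lies below the diagonal. *)
case/orP=> [ji|ij]; first by rewrite (upper_trigP _ (valP A)) ?mul0r.
by rewrite (upper_trigP _ (valP B)) ?mulr0.
Qed.
HB.instance Definition _ i := GRing.isZmodMorphism.Build (trig_mx R n) R
  (trig_diag i) (trig_diag_zmod_morphism i).
HB.instance Definition _ i := GRing.isMonoidMorphism.Build (trig_mx R n) R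
  (trig_diag i) (trig_diag_monoid_morphism i).

(** Each strictly upper triangular factor pushes the support at least one diagonal further up. *)
Lemma strict_upper_exp (A : 'M[R]_n) m :
    (forall i j : 'I_n, (j <= i)%N -> A i j = 0) ->
  forall i j : 'I_n, (j < i + m)%N -> (A ^+ m) i j = 0.
Proof.
move=> A0; elim: m => [|m IHm] i j.
  by rewrite addn0 => ji; rewrite expr0 mxE -val_eqE gtn_eqF.
move=> jim; rewrite exprS mxE big1 // => k _; have [ki|ik] := leqP k i.
  by rewrite A0 ?mul0r.
by rewrite IHm ?mulr0 // (leq_trans jim) // addnS -addSn leq_add2r.
Qed.

Lemma diag_upper_trig (r : 'rV[R]_n) : diag_mx r \in upper_trig (R := R) (n := n).
Proof.
by apply/upper_trigP => i j ji; rewrite mxE -val_eqE gtn_eqF ?mulr0n.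
Qed.

Lemma two_DeltaU_trig_mx : (0 < n)%N -> two_DeltaU (trig_mx R n) <-> two_DeltaU R.
Proof.
move=> n_gt0; apply: (@two_DeltaU_nil_kernel _ _ 'I_n trig_diag).
- move=> r; exists (TrigMx (diag_upper_trig (\row_j r j))) => i.
  by rewrite /= /trig_diag /= !mxE eqxx mulr1n.
(* A zero diagonal makes [A] strictly upper triangular; exponent [n] kills every entry because j < n
   <= i + n. *)
- move=> A A0; exists n; apply: val_inj; rewrite rmorphXn rmorph0.
  apply/matrixP => i j; rewrite [RHS]mxE strict_upper_exp //; last first.
    by rewrite (leq_trans (ltn_ord j)) ?leq_addl.
  move=> k l; rewrite leq_eqVlt => /orP[/eqP/val_inj->|]; first exact: A0.
  exact: (upper_trigP _ (valP A)).
- by split; exact: Ordinal n_gt0.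
Qed.

End UpperTriangular.

Theorem proposition4p6 (R : pzRingType) (M : bimodType R)
    (alpha : {rmorphism R -> R}) :
  [/\ two_DeltaU (trivext M) <-> two_DeltaU R,
      forall n : nat, (2 <= n)%N ->
        two_DeltaU (quot_ring (ideal_gen (skew_polyX alpha ^+ n))) <->
        two_DeltaU R,
      forall n : nat, (2 <= n)%N ->
        two_DeltaU (quot_ring (ideal_gen (skew_seriesX alpha ^+ n))) <->
        two_DeltaU R &
      forall n : nat, (1 <= n)%N ->
        two_DeltaU (trig_mx R n) <-> two_DeltaU R].
Proof.
split; first exact: two_DeltaU_trivext.
- by move=> n /ltnW; exact: two_DeltaU_skew_poly.
- by move=> n /ltnW; exact: two_DeltaU_skew_series.
- by move=> n; exact: two_DeltaU_trig_mx.
Qed.
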